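(* Let $\mu>0$, $k>0$, $H<0$, and put $a=-k/(2H)$. Let $\Pi\subset\mathbb{R}^3$ be a plane through the origin $\mathbf{0}$, and let $\mathbf{r}\in\Pi$ be a fixed point whose length $r=|\mathbf{r}|$ satisfies $0<r<a$. Let $\mathcal{F}$ be the one-parameter family of all Kepler ellipses $\mathcal{E}$ in $\Pi$ with energy $H$ passing through $\mathbf{r}$ (including the degenerate one), and for $\mathcal{E}\in\mathcal{F}$ let $\mathbf{K}$ be its Lenz vector, $\mathbf{t}=\mathbf{K}/(\mu H)$ its second focus, and $\mathcal{D}=\mathbf{d}+\mathbf{K}^{\perp}$ its directrix with respect to the origin, all as defined in the context. Put $\mathbf{u}=a\mathbf{r}/(a-r)$. Then for every $\mathcal{E}\in\mathcal{F}$ the orthogonal reflection $\mathbf{v}$ of the vector $\mathbf{u}$ in the line $\mathcal{D}$ (within the plane $\Pi$) is equal to $$\mathbf{v}=\frac{a\,\mathbf{r}}{a-r}-\frac{r\,\mathbf{t}}{a-r},$$ which in turn implies that $$\mathbf{v}-\mathbf{r}=\frac{r(\mathbf{r}-\mathbf{t})}{a-r}.$$ In particular $|\mathbf{v}-\mathbf{r}|=(2a-r)r/(a-r)$, and so $\mathbf{v}$ moves along the circle in $\Pi$ with center $\mathbf{r}$ and radius $(2a-r)r/(a-r)$ as $\mathcal{E}$ moves in the family $\mathcal{F}$. Hence the family of directrices $\mathcal{D}$ of the ellipses $\mathcal{E}\in\mathcal{F}$ is the family of tangent lines to the ellipse $\mathbf{E}$ in $\Pi$ with foci $\mathbf{r}$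 and $\mathbf{u}=a\mathbf{r}/(a-r)$, with long (major) axis equal to $(2a-r)r/(a-r)$, and with eccentricity $$\frac{r^2/(a-r)}{(2a-r)r/(a-r)}=\frac{r}{2a-r}.$$
   Context: Kepler problem: the equation of motion $\mu\ddot{\mathbf{x}}=-k\mathbf{x}/|\mathbf{x}|^3$ on $\mathbb{R}^3\setminus\{\mathbf{0}\}$, with momentum $\mathbf{p}=\mu\dot{\mathbf{x}}$, angular momentum $\mathbf{L}=\mathbf{x}\times\mathbf{p}$ and energy $H=|\mathbf{p}|^2/(2\mu)-k/|\mathbf{x}|$. Scalars $r,p,L,K$ denote the lengths of the vectors $\mathbf{r},\mathbf{p},\mathbf{L},\mathbf{K}$. The family $\mathcal{F}$: fix the plane $\Pi\ni\mathbf{0},\mathbf{r}$ and the energy $H<0$. The members of $\mathcal{F}$ are the orbits $\mathcal{E}$ of the Kepler problem in $\Pi$ passing through the position $\mathbf{r}$ with a momentum $\mathbf{p}\in\Pi$ at that point satisfying $p^2/(2\mu)-k/r=H$; so $\mathcal{F}$ is parametrized by the direction of $\mathbf{p}$ in $\Pi$ (with $\mathbf{p}$ and $-\mathbf{p}$ giving the same orbit). For such $\mathbf{p}$ put $\mathbf{L}=\mathbf{r}\times\mathbf{p}$ and define the Lenz vector $$\mathbf{K}=\mathbf{p}\times\mathbf{L}-k\mu\,\mathbf{r}/r\in\Pi.$$ If $\mathbf{L}\neq\mathbf{0}$, the orbit $\mathcal{E}$ is the ellipse in $\Pi$ with foci $\mathbf{0}$ and $\mathbf{t}=\mathbf{K}/(\mu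 H)$ and major axis $2a=-k/H$, that is, $\{\mathbf{x}\in\Pi: |\mathbf{x}|+|\mathbf{x}-\mathbf{t}|=2a\}$; its eccentricity is $e=K/(k\mu)$. If $\mathbf{L}=\mathbf{0}$ (so $\mathbf{p}$ is parallel to $\mathbf{r}$), $\mathcal{E}$ is regarded as a degenerate ellipse (a line segment, $e=1$) with the same formulas for $\mathbf{K}$ and $\mathbf{t}$. Since $0<r<a$ one has $\mathbf{K}\neq\mathbf{0}$ for all members of $\mathcal{F}$. The directrix of $\mathcal{E}$ with respect to the origin is the line $\mathcal{D}=\mathbf{d}+\mathbf{K}^{\perp}$ in $\Pi$, where $\mathbf{d}=L^2\mathbf{K}/K^2$ and $\mathbf{K}^{\perp}$ is the orthogonal complement of $\mathbf{K}$ in $\Pi$. For the degenerate member this gives $\mathcal{D}=\mathbf{r}^{\perp}$. The major (long) axis of an ellipse means the constant sum of the distances of its points to the two foci (the full length $2a$, not the half-length); the eccentricity is the distance between the foci divided by the major axis. *)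

(* Defs.v *)
From HB Require Import structures.
From mathcomp Require Import all_boot all_order all_algebra.
From mathcomp Require Import all_classical all_reals all_analysis.

Set Implicit Arguments.
Unset Strict Implicit.
Unset Printing Implicit Defensive.

Import Order.TTheory GRing.Theory Num.Theory.
Import numFieldNormedType.Exports.

Local Open Scope classical_set_scope.
Local Open Scope ring_scope.

(* The library norm `|x| on row vectors is the sup norm; [enorm] is the
   Euclidean length. *)
Definition dotp (R : realType) (u v : 'rV[R]_3) : R :=
  \sum_(i < 3) u 0 i * v 0 i.

Definition enorm (R : realType) (u : 'rV[R]_3) : R := Num.sqrt (dotp u u).

(* Indices are added modulo 3. *)
Definition crossp (R : realType) (u v : 'rV[R]_3) : 'rV[R]_3 :=
  \row_(i < 3) (u 0 (i + 1) * v 0 (i + 2%:R) - u 0 (i + 2%:R) * v 0 (i + 1)).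

(* [A] is the full length of the major axis. *)
Definition ellipse (R : realType) (Pi : {vspace 'rV[R]_3})
    (f1 f2 : 'rV[R]_3) (A : R) : set 'rV[R]_3 :=
  [set x | x \in Pi /\ enorm (x - f1) + enorm (x - f2) = A].

Definition eccentricity (R : realType) (f1 f2 : 'rV[R]_3) (A : R) : R :=
  enorm (f2 - f1) / A.

Definition circle (R : realType) (Pi : {vspace 'rV[R]_3})
    (c : 'rV[R]_3) (rho : R) : set 'rV[R]_3 :=
  [set x | x \in Pi /\ enorm (x - c) = rho].

(* Tangent directions of S at y are the nonzero velocities at y of curves
   lying in S. *)
Definition tangent_line (R : realType) (S l : set 'rV[R]_3) : Prop :=
  exists (y w : 'rV[R]_3) (g : R -> 'rV[R]_3),
    [/\ g 0 = y,
        \forall s \near (0 : R), S (g s),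
        is_derive (0 : R) 1 g w,
        w != 0
      & l = [set x | exists c : R, x = y + c *: w]].

Definition reflection_in (R : realType) (Pi : {vspace 'rV[R]_3})
    (D : set 'rV[R]_3) (x v : 'rV[R]_3) : Prop :=
  [/\ v \in Pi,
      D (2%:R^-1 *: (x + v))
    & forall y z, D y -> D z -> dotp (v - x) (y - z) = 0].

Definition lenz (R : realType) (mu k : R) (r p : 'rV[R]_3) : 'rV[R]_3 :=
  crossp p (crossp r p) - (k * mu / enorm r) *: r.

Definition second_focus (R : realType) (mu k H : R) (r p : 'rV[R]_3) :
    'rV[R]_3 :=
  (mu * H)^-1 *: lenz mu k r p.

Definition directrix (R : realType) (mu k : R) (Pi : {vspace 'rV[R]_3})
    (r p : 'rV[R]_3) : set 'rV[R]_3 :=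
  let K := lenz mu k r p in
  let d := (enorm (crossp r p) ^+ 2 / enorm K ^+ 2) *: K in
  [set x | exists n, [/\ n \in Pi, dotp n K = 0 & x = d + n]].

Definition kepler_motion (R : realType) (mu k : R) (x : R -> 'rV[R]_3) : Prop :=
  forall s : R,
    [/\ x s != 0,
        derivable x s 1,
        derivable (derive1 x) s 1
      & mu *: derive1 (derive1 x) s = - (k / enorm (x s) ^+ 3) *: x s].

(* Motions with nonzero angular momentum exist for all times, so the orbit is
   the range of a motion defined on the whole of R. *)
Definition kepler_orbit (R : realType) (mu k : R) (Pi : {vspace 'rV[R]_3})
    (r p : 'rV[R]_3) (E : set 'rV[R]_3) : Prop :=
  exists x : R -> 'rV[R]_3,
    [/\ kepler_motion mu k x,
        forall s, x s \in Pi,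
        exists s, x s = r /\ mu *: derive1 x s = p
      & E = range x].

(* E is the member of the family with momentum p at r.  For zero angular
   momentum (collision) E is by convention the degenerate ellipse, that is the
   segment joining the two foci. *)
Definition kepler_family (R : realType) (mu k H : R) (Pi : {vspace 'rV[R]_3})
    (r p : 'rV[R]_3) (E : set 'rV[R]_3) : Prop :=
  [/\ p \in Pi,
      enorm p ^+ 2 / (2%:R * mu) - k / enorm r = H,
      crossp r p != 0 -> kepler_orbit mu k Pi r p E
    & crossp r p = 0 -> E = ellipse Pi 0 (second_focus mu k H r p) (- k / H)].

(* Main.v *)
Require Import Defs.
From HB Require Import structures.
From mathcomp Require Import all_boot all_order all_algebra.
From mathcomp Require Import all_classical all_reals all_analysis.
From mathcomp Require Import ring lra.

Set Implicit Arguments.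
Unset Strict Implicit.
Unset Printing Implicit Defensive.

Import Order.TTheory GRing.Theory Num.Theory.
Import numFieldNormedType.Exports.

Local Open Scope classical_set_scope.
Local Open Scope ring_scope.

(** Write [t] for the second focus of a member of the family.  Since [r] lies on
    the Kepler ellipse, [t] lies on the circle of radius [2 a - |r|] about [r].
    In terms of [t] the directrix is the line

      D t = { x in Pi | (x - r).t = - 2 a |r| }            ([directrixE]),

    a line orthogonal to [t], so reflecting [u] in it moves [u] by a multiple of
    [t], and the midpoint condition fixes this multiple as [- |r| / (a - |r|)].
    Therefore [v - r] is the dilation of [r - t] by the factor
    [s = |r| / (a - |r|)], and has the constant length [A = s (2 a - |r|)].

    The envelope statement rests on the classical fact that the reflections of
    one focus in the tangents of an ellipse fill the circle about the other
    focus whose radius is the major axis.  [tangent_line_ellipseP] is this fact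
    in the form of equations: the tangents of the ellipse with foci [f1], [f2]
    and axis [A] are the perpendicular bisectors of [f2] and [f1 + A w], for [w]
    a unit vector of the plane.  For [f1 = r], [f2 = u] and
    [r - t = (2 a - |r|) w] this bisector is [D t].

    So both families of lines are parametrized by the points [t] of the circle
    of radius [2 a - |r|] about [r], provided that every such [t] is the second
    focus of a member of the family.  A momentum for it is found by the focal
    property of the tangent ([momentum_of_focus]): up to a scalar,
    [t - r] is the mirror image of [r] in the line spanned by [p].  If [r] and
    [p] are not parallel, a motion with these initial data, defined for all
    times, must still be exhibited ([kepler_orbit_exists]): it is written in
    the basis [r], [p] with the Lagrange coefficients, elementary functions of
    the increment [Z] of the eccentric anomaly, and [Z] is obtained as a
    function of time by inverting the Kepler equation
    ([derivative_pos_inverse]). *)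

(** * Vector algebra in dimension three *)

Lemma row3P (R : realType) (u v : 'rV[R]_3) :
  u 0 0 = v 0 0 -> u 0 1 = v 0 1 -> u 0 2%:R = v 0 2%:R -> u = v.
Proof.
move=> h0 h1 h2; apply/rowP => -[[|[|[|//]]] lti].
- by have -> : Ordinal lti = 0 by exact/val_inj.
- by have -> : Ordinal lti = 1 by exact/val_inj.
- by have -> : Ordinal lti = 2%:R by exact/val_inj.
Qed.

Lemma dotpE (R : realType) (u v : 'rV[R]_3) :
  dotp u v = u 0 0 * v 0 0 + u 0 1 * v 0 1 + u 0 2%:R * v 0 2%:R.
Proof.
rewrite /dotp !big_ord_recl big_ord0 addr0 -!addrA.
have -> : lift ord0 ord0 = 1 :> 'I_3 by exact/val_inj.
by have -> : lift ord0 (lift ord0 ord0) = 2%:R :> 'I_3 by exact/val_inj.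
Qed.

Lemma crossp0E (R : realType) (u v : 'rV[R]_3) :
  crossp u v 0 0 = u 0 1 * v 0 2%:R - u 0 2%:R * v 0 1.
Proof. by rewrite mxE !add0r. Qed.

Lemma crossp1E (R : realType) (u v : 'rV[R]_3) :
  crossp u v 0 1 = u 0 2%:R * v 0 0 - u 0 0 * v 0 2%:R.
Proof.
rewrite mxE; have -> : 1 + 1 = 2%:R :> 'I_3 by exact/val_inj.
by have -> : 1 + 2%:R = 0 :> 'I_3 by exact/val_inj.
Qed.

Lemma crossp2E (R : realType) (u v : 'rV[R]_3) :
  crossp u v 0 2%:R = u 0 0 * v 0 1 - u 0 1 * v 0 0.
Proof.
rewrite mxE; have -> : 2%:R + 1 = 0 :> 'I_3 by exact/val_inj.
by have -> : 2%:R + 2%:R = 1 :> 'I_3 by exact/val_inj.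
Qed.

Definition crosspE := (crossp0E, crossp1E, crossp2E).

Lemma dotpC (R : realType) (u v : 'rV[R]_3) : dotp u v = dotp v u.
Proof. by apply: eq_bigr => i _; rewrite mulrC. Qed.

Lemma dotpDl (R : realType) (u v w : 'rV[R]_3) :
  dotp (u + v) w = dotp u w + dotp v w.
Proof. by rewrite -big_split; apply: eq_bigr => i _; rewrite mxE mulrDl. Qed.

Lemma dotpZl (R : realType) (c : R) (u v : 'rV[R]_3) :
  dotp (c *: u) v = c * dotp u v.
Proof. by rewrite mulr_sumr; apply: eq_bigr => i _; rewrite mxE mulrA. Qed.

Lemma dotpDr (R : realType) (u v w : 'rV[R]_3) :
  dotp w (u + v) = dotp w u + dotp w v.
Proof. by rewrite dotpC dotpDl !(dotpC w). Qed.

Lemma dotpZr (R : realType) (c : R) (u v : 'rV[R]_3) :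
  dotp u (c *: v) = c * dotp u v.
Proof. by rewrite dotpC dotpZl dotpC. Qed.

Lemma dotpNl (R : realType) (u v : 'rV[R]_3) : dotp (- u) v = - dotp u v.
Proof. by rewrite -scaleN1r dotpZl mulN1r. Qed.

Lemma dotpNr (R : realType) (u v : 'rV[R]_3) : dotp u (- v) = - dotp u v.
Proof. by rewrite dotpC dotpNl dotpC. Qed.

Lemma dotp0l (R : realType) (v : 'rV[R]_3) : dotp 0 v = 0.
Proof. by rewrite -(scale0r 0) dotpZl mul0r. Qed.

(** Turns a dot product of linear combinations into a polynomial in the
    pairwise dot products, on which the field tactics work. *)
Definition dotp_lin := (dotpDl, dotpDr, dotpNl, dotpNr, dotpZl, dotpZr).

Lemma dotp_ge0 (R : realType) (u : 'rV[R]_3) : 0 <= dotp u u.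
Proof. by apply: sumr_ge0 => i _; rewrite -expr2 sqr_ge0. Qed.

Lemma dotp_eq0 (R : realType) (u : 'rV[R]_3) : (dotp u u == 0) = (u == 0).
Proof.
apply/idP/eqP => [|->]; last by rewrite dotp0l.
rewrite psumr_eq0 => [/allP h|i _]; last by rewrite -expr2 sqr_ge0.
apply/rowP => i; rewrite mxE; apply/eqP.
by have := h i; rewrite mem_index_enum mulf_eq0 orbb => /(_ isT).
Qed.

Lemma dotp_gt0 (R : realType) (u : 'rV[R]_3) : (0 < dotp u u) = (u != 0).
Proof. by rewrite lt0r dotp_ge0 andbT dotp_eq0. Qed.

Lemma enorm_sqr (R : realType) (u : 'rV[R]_3) : enorm u ^+ 2 = dotp u u.
Proof. by rewrite sqr_sqrtr ?dotp_ge0. Qed.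

Lemma enorm_ge0 (R : realType) (u : 'rV[R]_3) : 0 <= enorm u.
Proof. exact: sqrtr_ge0. Qed.

Lemma enorm_eq (R : realType) (u : 'rV[R]_3) (c : R) :
  0 <= c -> (enorm u = c) <-> (dotp u u = c ^+ 2).
Proof.
by move=> c0; split=> [<-|h]; rewrite ?enorm_sqr// /enorm h sqrtr_sqr ger0_norm.
Qed.

Lemma enorm_gt0 (R : realType) (u : 'rV[R]_3) : (0 < enorm u) = (u != 0).
Proof. by rewrite sqrtr_gt0 dotp_gt0. Qed.

Lemma enormZ (R : realType) (c : R) (u : 'rV[R]_3) :
  0 <= c -> enorm (c *: u) = c * enorm u.
Proof.
by move=> c0; apply/enorm_eq; rewrite ?mulr_ge0 ?enorm_ge0// exprMn enorm_sqr;
  rewrite !dotp_lin; ring.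
Qed.

Lemma enormN (R : realType) (u : 'rV[R]_3) : enorm (- u) = enorm u.
Proof. by rewrite /enorm dotpNl dotpNr opprK. Qed.

Lemma crossp_crossp (R : realType) (u v w : 'rV[R]_3) :
  crossp u (crossp v w) = dotp u w *: v - dotp u v *: w.
Proof.
have cE (a b : R) (x y : 'rV[R]_3) i :
  (a *: x - b *: y) 0 i = a * x 0 i - b * y 0 i by rewrite !mxE.
by apply: row3P; rewrite cE !crosspE !dotpE; ring.
Qed.

Lemma dotp_crossp (R : realType) (u v : 'rV[R]_3) :
  dotp (crossp u v) (crossp u v) = dotp u u * dotp v v - dotp u v ^+ 2.
Proof. by rewrite !dotpE !crosspE; ring. Qed.

Lemma dotp_crosspl (R : realType) (u v : 'rV[R]_3) : dotp u (crossp u v) = 0.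
Proof. by rewrite !dotpE !crosspE; ring. Qed.

Lemma dotp_crosspr (R : realType) (u v : 'rV[R]_3) : dotp v (crossp u v) = 0.
Proof. by rewrite !dotpE !crosspE; ring. Qed.

Lemma dotp_le (R : realType) (u v : 'rV[R]_3) : dotp u v <= enorm u * enorm v.
Proof.
rewrite (le_trans (ler_norm _))// -ler_sqr ?nnegrE ?mulr_ge0 ?enorm_ge0//.
by rewrite -normrX ger0_norm ?sqr_ge0// exprMn !enorm_sqr -subr_ge0 -dotp_crossp
  dotp_ge0.
Qed.

Lemma crossp0r (R : realType) (u : 'rV[R]_3) : crossp u 0 = 0.
Proof. by apply: row3P; rewrite crosspE !mxE; ring. Qed.

Lemma crossp_anti (R : realType) (u v : 'rV[R]_3) : crossp u v = - crossp v u.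
Proof.
have NE (x : 'rV[R]_3) i : (- x) 0 i = - x 0 i by rewrite mxE.
by apply: row3P; rewrite NE !crosspE; ring.
Qed.

Lemma crosspZr (R : realType) (c : R) (u v : 'rV[R]_3) :
  crossp u (c *: v) = c *: crossp u v.
Proof.
have ZE (x : 'rV[R]_3) i : (c *: x) 0 i = c * x 0 i by rewrite mxE.
by apply: row3P; rewrite ZE !crosspE !ZE; ring.
Qed.

Lemma dotp_crossp_rot (R : realType) (u v w : 'rV[R]_3) :
  dotp u (crossp v w) = dotp v (crossp w u).
Proof. by rewrite !dotpE !crosspE; ring. Qed.

(** * Geometry of a plane *)

Definition unit_normal (R : realType) (Pi : {vspace 'rV[R]_3})
    (nu : 'rV[R]_3) :=
  dotp nu nu = 1 /\ forall x, x \in Pi <-> dotp x nu = 0.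

Lemma plane_normal (R : realType) (Pi : {vspace 'rV[R]_3}) :
  \dim Pi = 2%N -> exists nu, unit_normal Pi nu.
Proof.
move=> d2; have := vbasisP Pi; move: (vbasis Pi); rewrite d2 => b.
case/tupleP: b => b1 b; case/tupleP: b => b2 b; rewrite tuple0 /=.
move=> /andP[/eqP sp fr].
have b1P : b1 \in Pi by rewrite -sp memv_span// !inE eqxx.
have b2P : b2 \in Pi by rewrite -sp memv_span// !inE eqxx orbT.
pose N := crossp b1 b2.
have N0 : N != 0.
  apply/eqP => N0; have := crossp_crossp b2 b1 b2; rewrite -/N N0 crossp0r.
  move=> /esym/eqP; rewrite subr_eq0 => /eqP e.
  move: fr; rewrite free_cons span_seq1 seq1_free => /andP[/negP nb1 b20].
  apply: nb1; apply/vlineP; exists ((dotp b2 b2)^-1 * dotp b2 b1).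
  by rewrite -scalerA -e scalerA mulVf ?scale1r// dotp_eq0.
have NN : dotp N N != 0 by rewrite dotp_eq0.
have eN : enorm N != 0 by rewrite gt_eqF// enorm_gt0.
exists ((enorm N)^-1 *: N); split.
  by rewrite !dotp_lin -enorm_sqr; field.
have perpN x : dotp x N = 0 <-> dotp x ((enorm N)^-1 *: N) = 0.
  by rewrite dotpZr; split=> [->|/eqP]; rewrite ?mulr0// mulf_eq0 invr_eq0
    (negbTE eN) => /eqP.
move=> x; split=> [|/perpN xN].
  rewrite -sp span_cons span_seq1.
  move=> /memv_addP[_ /vlineP[c ->]] [_ /vlineP[d ->]] ->; apply/perpN.
  by rewrite !dotp_lin dotp_crosspl dotp_crosspr; ring.
(* By the triple product formula every vector product with N is a combination
   of the basis vectors, and a vector x orthogonal to N is a multiple of such a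
   product, namely of the product of N with the product of x and N. *)
have cP y : crossp N y \in Pi.
  by rewrite crossp_anti memvN (crossp_crossp y b1 b2) memvB// memvZ.
have := crossp_crossp N x N; rewrite (dotpC N x) xN scale0r subr0 => e.
by rewrite -[x]scale1r -(mulVf NN) -scalerA -e memvZ.
Qed.

Lemma memv_crossp_normal (R : realType) (Pi : {vspace 'rV[R]_3})
    (nu x : 'rV[R]_3) :
  unit_normal Pi nu -> crossp nu x \in Pi.
Proof. by move=> [_ nuP]; apply/nuP; rewrite dotpC dotp_crosspl. Qed.

Lemma dotp_crossp_normal (R : realType) (Pi : {vspace 'rV[R]_3})
    (nu x : 'rV[R]_3) :
  unit_normal Pi nu -> x \in Pi -> dotp (crossp nu x) (crossp nu x) = dotp x x.
Proof.
by move=> [nu1 nuP] /nuP xnu; rewrite dotp_crossp nu1 (dotpC nu) xnu; ring.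
Qed.

(** The vector product with the unit normal is the quarter turn of the plane;
    a nonzero vector and its quarter turn form an orthogonal basis. *)
Lemma plane_decomp (R : realType) (Pi : {vspace 'rV[R]_3}) (nu x z : 'rV[R]_3) :
  unit_normal Pi nu -> x \in Pi -> z \in Pi ->
  dotp x x *: z = dotp z x *: x + dotp z (crossp nu x) *: crossp nu x.
Proof.
move=> [nu1 nuP] /nuP xnu /nuP znu.
have e1 : crossp z x = - dotp z (crossp nu x) *: nu.
  have := crossp_crossp nu nu (crossp z x).
  rewrite (crossp_crossp nu z x) !(dotpC nu) xnu znu nu1 !scale0r subrr.
  rewrite crossp0r.
  move/esym/eqP; rewrite scale1r subr_eq0 => /eqP <-.
  by rewrite dotpC dotp_crossp_rot (crossp_anti x) dotpNr.
have := crossp_crossp x z x; rewrite e1 crosspZr (crossp_anti x).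
rewrite scaleNr scalerN opprK (dotpC x z) => ->.
by rewrite addrC subrK.
Qed.

Lemma plane_orthogonal_line (R : realType) (Pi : {vspace 'rV[R]_3})
    (n z w : 'rV[R]_3) :
  \dim Pi = 2%N -> n \in Pi -> z \in Pi -> w \in Pi -> n != 0 -> w != 0 ->
  dotp z n = 0 -> dotp w n = 0 -> exists c, z = c *: w.
Proof.
move=> /plane_normal[nu nuP] nPi zPi wPi n0 w0 zn wn.
have nn : dotp n n != 0 by rewrite dotp_eq0.
have := plane_decomp nuP nPi zPi; rewrite zn scale0r add0r => ze.
have := plane_decomp nuP nPi wPi; rewrite wn scale0r add0r => we.
set J := crossp nu n in ze we.
have wJ : dotp w J != 0.
  apply: contra_neq w0 => wJ; move: we; rewrite wJ scale0r => /eqP.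
  by rewrite scaler_eq0 (negbTE nn) => /eqP.
exists (dotp z J / dotp w J).
apply: (scalerI nn); rewrite ze scalerA mulrC -scalerA we scalerA.
by congr (_ *: _); field.
Qed.

Lemma plane_line_setE (R : realType) (Pi : {vspace 'rV[R]_3})
    (n o y w : 'rV[R]_3) (b : R) :
  \dim Pi = 2%N -> n \in Pi -> y \in Pi -> w \in Pi -> n != 0 -> w != 0 ->
  dotp w n = 0 -> dotp (y - o) n = b ->
  [set x | exists c : R, x = y + c *: w]
    = [set x | x \in Pi /\ dotp (x - o) n = b].
Proof.
move=> d2 nPi yPi wPi n0 w0 wn yn; apply/seteqP; split=> x /=.
  move=> [c ->]; split; first by rewrite memvD// memvZ.
  by rewrite addrAC dotpDl dotpZl wn mulr0 addr0.
move=> [xPi xn].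
have xyn : dotp (x - y) n = 0.
  by rewrite -(subrKA o) -(opprB y) dotpDl dotpNl xn yn subrr.
have [|c e] := plane_orthogonal_line d2 nPi _ wPi n0 w0 xyn wn.
  by rewrite memvB.
by exists c; rewrite -e addrC subrK.
Qed.

(** The equation for [c] says that the midpoint of [u] and [u + c t] lies on
    the line. *)
Lemma unique_reflection_in (R : realType) (Pi : {vspace 'rV[R]_3})
    (o t u : 'rV[R]_3) (b c : R) :
  \dim Pi = 2%N -> t \in Pi -> u \in Pi -> t != 0 ->
  dotp (u - o) t + c / 2 * dotp t t = b ->
  unique (reflection_in Pi [set x | x \in Pi /\ dotp (x - o) t = b] u)
    (u + c *: t).
Proof.
move=> d2 tPi uPi t0 cb.
have mid d : dotp (2%:R^-1 *: (u + (u + d *: t)) - o) t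
    = b + (d - c) / 2 * dotp t t.
  rewrite -cb (_ : _ - o = (u - o) + (d / 2) *: t); last first.
    by apply/rowP => i; rewrite !mxE; field.
  by rewrite dotpDl dotpZl; ring.
split.
  split; first by rewrite memvD// memvZ.
    by split; [rewrite memvZ// !memvD// memvZ|rewrite mid subrr !mul0r addr0].
  move=> y z [_ ye] [_ ze]; rewrite addrAC subrr add0r.
  have -> : y - z = (y - o) - (z - o) by rewrite opprB subrKA.
  by rewrite dotpZl dotpDr dotpNr !(dotpC t) ye ze subrr mulr0.
move=> v' [v'Pi [mPi mb] v'perp].
have [nu nuP] := plane_normal d2.
(* The midpoint and its translate by the quarter turn of t are two points of
   the line, so v' - u is orthogonal to that quarter turn, like t itself. *)
have nn : crossp nu t != 0.
  by rewrite -dotp_eq0 (dotp_crossp_normal nuP)// dotp_eq0.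
have perp : dotp (v' - u) (crossp nu t) = 0.
  have := v'perp (2%:R^-1 *: (u + v') + crossp nu t) (2%:R^-1 *: (u + v')).
  rewrite addrAC subrr add0r; apply=> //; split.
    by rewrite memvD// (memv_crossp_normal _ nuP).
  by rewrite addrAC dotpDl mb (dotpC (crossp nu t)) dotp_crosspr addr0.
have [d dE] : exists d, v' - u = d *: t.
  apply: (plane_orthogonal_line (n := crossp nu t) d2) => //.
  - exact: memv_crossp_normal nuP.
  - by rewrite memvB.
  - by rewrite dotp_crosspr.
have v'E : v' = u + d *: t by rewrite -dE addrC subrK.
have : (d - c) / 2 * dotp t t == 0.
  by apply/eqP; apply: (addrI b); rewrite addr0 -mid -v'E.
rewrite !mulf_eq0 dotp_eq0 (negbTE t0) orbF invr_eq0 pnatr_eq0 orbF subr_eq0.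
by rewrite v'E => /eqP ->.
Qed.

(** * Derivatives of vector-valued curves *)

Lemma is_derive_rVP (R : realType) (g : R -> 'rV[R]_3) (t : R) (dg : 'rV[R]_3) :
  is_derive t 1 g dg <->
  forall i, is_derive t 1 (fun s => g s 0 i : R) (dg 0 i).
Proof.
split=> [[d <-] i|h].
  by split; [exact: (derivable_mxP g t 1).1|rewrite derive_mx// mxE].
have d : derivable g t 1.
  by apply/derivable_mxP => i j; rewrite ord1; case: (h j).
by split=> //; rewrite derive_mx//; apply/rowP => i; rewrite mxE; case: (h i).
Qed.

Lemma is_derive_scale_vec (R : realType) (f : R -> R) (t df : R)
    (r : 'rV[R]_3) :
  is_derive t 1 f df -> is_derive t 1 (fun s => f s *: r) (df *: r).
Proof.
move=> fd; apply/is_derive_rVP => i; rewrite mxE.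
have -> : (fun s => (f s *: r) 0 i : R) = (f * cst (r 0 i)).
  by apply/funext => s; rewrite mxE.
by apply: is_derive_eq; rewrite scaler0 add0r /GRing.scale /= mulrC.
Qed.

Lemma is_derive_dotp (R : realType) (g h : R -> 'rV[R]_3) (t : R)
    (dg dh : 'rV[R]_3) :
  is_derive t 1 g dg -> is_derive t 1 h dh ->
  is_derive t 1 (fun s => dotp (g s) (h s)) (dotp dg (h t) + dotp (g t) dh).
Proof.
move=> /is_derive_rVP gd /is_derive_rVP hd.
have -> : (fun s => dotp (g s) (h s)) =
    \sum_(i < 3) ((fun s => g s 0 i : R) * (fun s => h s 0 i : R)).
  by apply/funext => s; rewrite fct_sumE.
apply: is_derive_eq; rewrite /dotp -big_split; apply: eq_bigr => i _ /=.
by rewrite /GRing.scale /= addrC (mulrC (h t 0 i)).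
Qed.

Lemma near_cst_is_derive (R : realType) (g : R -> R) (t c dg : R) :
  (\forall s \near t, g s = c) -> is_derive t 1 g dg -> dg = 0.
Proof.
move=> gc gd; have [_ <-] : is_derive t 1 (cst c) dg.
  exact: near_eq_is_derive gd.
exact: derive_cst.
Qed.

(** * Tangent lines of an ellipse *)

(** Expanding the square of [|x - f2| = A - |x - f1|] eliminates the second
    square root: on the ellipse the distance to [f1] is an affine function of
    the position, which is the focus-directrix property. *)
Lemma ellipse_focal (R : realType) (Pi : {vspace 'rV[R]_3})
    (f1 f2 x : 'rV[R]_3) (A : R) :
  ellipse Pi f1 f2 A x ->
  2 * A * enorm (x - f1)
    = A ^+ 2 - enorm (f2 - f1) ^+ 2 + 2 * dotp (x - f1) (f2 - f1).
Proof.
move=> [_ /= <-].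
have -> : x - f2 = (x - f1) - (f2 - f1) by rewrite opprB subrKA.
move: (x - f1) (f2 - f1) => z c.
have := enorm_sqr (z - c); rewrite !dotp_lin -!enorm_sqr (dotpC c z) => e.
have -> : dotp z c = (enorm z ^+ 2 + enorm c ^+ 2 - enorm (z - c) ^+ 2) / 2.
  by rewrite e; field.
by field.
Qed.

(** The affine equation on the right is that of the perpendicular bisector of
    [f2] and [f1 + A w].  The point of contact is [f1 + rho w], where [rho] is
    given by the polar equation of the ellipse about [f1],
    [rho = (A^2 - |c|^2) / (2 (A - w.c))] with [c = f2 - f1]. *)
Lemma tangent_line_ellipseP (R : realType) (Pi : {vspace 'rV[R]_3})
    (f1 f2 : 'rV[R]_3) (A : R) (l : set 'rV[R]_3) :
  \dim Pi = 2%N -> f1 \in Pi -> f2 \in Pi -> enorm (f2 - f1) < A ->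
  tangent_line (ellipse Pi f1 f2 A) l <->
  exists w, [/\ w \in Pi, dotp w w = 1
    & l = [set x | x \in Pi /\ dotp (x - f1) (A *: w - (f2 - f1))
                     = (A ^+ 2 - enorm (f2 - f1) ^+ 2) / 2]].
Proof.
move=> d2 f1P f2P cA; set c := f2 - f1.
set B := (A ^+ 2 - enorm c ^+ 2) / 2.
have c0 := enorm_ge0 c.
have A0 : 0 < A by exact: le_lt_trans cA.
have B0 : 0 < B.
  by rewrite divr_gt0 ?subr_gt0// ltr_sqr ?nnegrE ?(ltW A0).
have cP : c \in Pi by rewrite memvB.
split.
  move=> [y [w [g [g0 gE gd w0 ->]]]].
  have gy : ellipse Pi f1 f2 A y by rewrite -g0; exact: nbhs_singleton gE.
  have [yPi _] := gy.
  have foc := ellipse_focal gy; rewrite -/c in foc.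
  set rho := enorm (y - f1) in foc.
  have rho0 : 0 < rho.
    rewrite enorm_gt0; apply/eqP => yf; move: foc B0.
    by rewrite /rho /B yf dotp0l /enorm dotp0l sqrtr0 => foc; lra.
  have [nu nuP] := plane_normal d2.
  have wPi : w \in Pi.
    have [_ inPi] := nuP; apply/inPi.
    apply: (@near_cst_is_derive _ (fun s => dotp (g s) nu) 0 0).
      by apply: filterS gE => s [/inPi].
    have nud : is_derive (0 : R) 1 (cst nu) 0 by exact: is_derive_cst.
    by have := is_derive_dotp gd nud;
      rewrite (dotpC _ 0) dotp0l addr0.
  have eB : B + dotp (y - f1) c = A * rho.
    by rewrite /B; lra.
  (* Squaring the affine expression of the distance to f1 gives a polynomial
     equation of the ellipse, differentiable along every curve. *)
  have wn : A * dotp w (y - f1) = rho * dotp w c.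
    have zd : is_derive (0 : R) 1 (fun s => g s - f1) w.
      by apply: is_derive_eq; rewrite subr0.
    pose P := (4 * A ^+ 2) *: (fun s => dotp (g s - f1) (g s - f1))
      - (2 *: (cst B + (fun s => dotp (g s - f1) (cst c s)))) ^+ 2.
    have : is_derive (0 : R) 1 P
        (8 * A * (A * dotp w (y - f1) - rho * dotp w c)).
      have zzd := is_derive_dotp zd zd.
      have cd : is_derive (0 : R) 1 (cst c) 0 by exact: is_derive_cst.
      have zcd := is_derive_dotp zd cd.
      apply: is_derive_eq; rewrite /GRing.scale /= /cst g0.
      rewrite [X in _ * X ^+ 1](_ : _ = 2 * (A * rho)); last by rewrite -eB -g0.
      rewrite (dotpC _ 0) dotp0l (dotpC (y - f1) w); ring.
    move/(near_cst_is_derive (c := 0)) => P0.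
    have : 8 * A * (A * dotp w (y - f1) - rho * dotp w c) = 0.
      apply: P0; apply: filterS gE => s /ellipse_focal; rewrite -/c => e.
      have -> : P s = 4 * A ^+ 2 * dotp (g s - f1) (g s - f1)
          - (2 * (B + dotp (g s - f1) c)) ^+ 2 by [].
      rewrite -enorm_sqr (_ : 2 * (B + _) = 2 * A * enorm (g s - f1)).
        by ring.
      by rewrite e /B; field.
    move/eqP; rewrite mulf_eq0 gt_eqF ?mulr_gt0//= subr_eq0 => /eqP //.
  pose v := rho^-1 *: (y - f1); exists v.
  have vPi : v \in Pi by rewrite memvZ// memvB.
  have nPi : A *: v - c \in Pi by rewrite memvB// memvZ.
  have r0 : rho != 0 by rewrite gt_eqF.
  have v1 : dotp v v = 1 by rewrite /v dotpZl dotpZr -enorm_sqr -/rho; field.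
  have yn : dotp (y - f1) (A *: v - c) = B.
    rewrite dotpDr dotpNr /v !dotpZr -enorm_sqr -/rho.
    by rewrite (_ : dotp _ c = A * rho - B); [field|lra].
  split=> //; apply: (plane_line_setE d2 nPi) => //.
    apply/eqP => n0; move: yn B0; rewrite n0 dotpC dotp0l => <-.
    by rewrite ltxx.
  by rewrite dotpDr dotpNr /v !dotpZr mulrCA wn mulKf// subrr.
move=> [v [vPi v1 ->]].
have [nu nuP] := plane_normal d2.
pose J := crossp nu v.
have JPi : J \in Pi by exact: memv_crossp_normal.
have vJ : dotp v J = 0 by rewrite dotp_crosspr.
have JJ : dotp J J = 1 by rewrite (dotp_crossp_normal nuP).
(* The curve is the polar parametrization of the ellipse about f1, with D the
   denominator of the polar equation; s is the angle from v. *)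
pose D s := A - (cos s * dotp v c + sin s * dotp J c).
have Dge s : A - enorm c <= D s.
  rewrite /D -dotpZl -dotpZl -dotpDl lerD2l lerN2.
  set x := (cos s *: v + _ : 'rV[R]_3).
  apply: (le_trans (dotp_le _ _)).
  suff -> : enorm x = 1 by rewrite mul1r.
  apply/enorm_eq => //; rewrite /x !dotp_lin (dotpC J v) vJ v1 JJ.
  by rewrite expr1n -[RHS](cos2Dsin2 s); ring.
have Dgt s : 0 < D s by rewrite (lt_le_trans _ (Dge s))// subr_gt0.
pose rho s := B / D s.
pose g s := f1 + ((rho s * cos s) *: v + (rho s * sin s) *: J).
pose w := (B / D 0 ^+ 2 * dotp J c) *: v + (B / D 0) *: J.
have w0 : w != 0.
  apply/eqP => /(congr1 (dotp J)).
  rewrite (dotpC _ 0) dotp0l /w !dotp_lin (dotpC J v) vJ JJ mulr0 add0r mulr1.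
  by move/eqP; rewrite mulf_eq0 invr_eq0 !gt_eqF.
exists (g 0), w, g; split=> //.
- near=> s; split; first by rewrite !rpredD// rpredZ.
  have r0 : 0 < rho s by rewrite divr_gt0.
  have zz : dotp (g s - f1) (g s - f1) = rho s ^+ 2.
    rewrite /g addrC addKr !dotp_lin (dotpC J v) vJ v1 JJ.
    rewrite [LHS](_ : _ = rho s ^+ 2 * (cos s ^+ 2 + sin s ^+ 2)); last by ring.
    by rewrite cos2Dsin2 mulr1.
  have zc : dotp (g s - f1) c = rho s * (cos s * dotp v c + sin s * dotp J c).
    by rewrite /g addrC addKr !(dotpDl, dotpZl); ring.
  have rD : rho s * D s = B by rewrite /rho mulfVK// gt_eqF.
  have -> : enorm (g s - f1) = rho s by apply/enorm_eq => //; exact: ltW.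
  suff -> : enorm (g s - f2) = A - rho s by rewrite addrC subrK.
  have -> : g s - f2 = (g s - f1) - c by rewrite opprB subrKA.
  have rA : rho s <= A.
    rewrite ler_pdivrMr//; apply: (@le_trans _ _ (A * (A - enorm c))).
      rewrite -subr_ge0 (_ : _ - B = (A - enorm c) ^+ 2 / 2); last first.
        by rewrite /B; field.
      by rewrite divr_ge0 ?sqr_ge0.
    by rewrite ler_pM2l.
  apply/enorm_eq; first by rewrite subr_ge0.
  clearbody c; move: zz zc; move: (g s - f1) => z zz zc.
  rewrite !dotp_lin (dotpC c z) zz zc -enorm_sqr.
  move: rD; rewrite /B /D => rD; lra.
- have Dd : is_derive (0 : R) 1 D (- dotp J c).
    apply: is_derive_eq.
    by rewrite /GRing.scale /= sin0 cos0; ring.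
  have rhod : is_derive (0 : R) 1 rho (B / D 0 ^+ 2 * dotp J c).
    have D0n : D 0 != 0 by rewrite gt_eqF.
    have Vd := is_deriveV D0n Dd.
    apply: is_derive_eq.
    by rewrite /GRing.scale /=; field.
  have cd : is_derive (0 : R) 1 (fun s => rho s * cos s)
      (B / D 0 ^+ 2 * dotp J c).
    apply: is_derive_eq.
    by rewrite /GRing.scale /= sin0 cos0; ring.
  have sd : is_derive (0 : R) 1 (fun s => rho s * sin s) (B / D 0).
    apply: is_derive_eq.
    by rewrite /GRing.scale /= sin0 cos0 /rho; ring.
  have cvd := is_derive_scale_vec v cd.
  have sJd := is_derive_scale_vec J sd.
  by apply: is_derive_eq; rewrite add0r.
have rD : B / D 0 * (A - dotp v c) = B.
  have -> : A - dotp v c = D 0 by rewrite /D cos0 sin0; ring.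
  by rewrite mulfVK// gt_eqF.
have yn : dotp (g 0 - f1) (A *: v - c) = B.
  rewrite /g /rho cos0 sin0 mulr0 scale0r addr0 mulr1 addrC addKr.
  by rewrite dotpZl dotpDr dotpNr dotpZr v1 mulr1.
apply/esym; apply: plane_line_setE => //.
- by rewrite memvB// memvZ.
- by rewrite !rpredD// rpredZ.
- by rewrite rpredD// rpredZ.
- by apply/eqP => n0; move: yn B0; rewrite n0 dotpC dotp0l => <-; rewrite ltxx.
- clearbody J; move: (dotpC J v); rewrite vJ => Jv.
  rewrite /w dotpDl !dotpZl !(dotpDr (A *: v)) !(dotpNr _ c) !dotpZr v1 Jv.
  have -> : A = D 0 + dotp v c by rewrite /D cos0 sin0; ring.
  by field; rewrite gt_eqF.
Unshelve. all: by end_near. Qed.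

(** * Existence of Kepler motions *)

(** Used to invert the Kepler equation, where [f] differs from the identity by
    a trigonometric polynomial.  The bound makes [f] surjective by the
    intermediate value theorem, and the positive derivative makes it
    injective. *)
Lemma derivative_pos_inverse (R : realType) (f df : R -> R) (C : R) :
  (forall z : R, is_derive z 1 f (df z)) -> (forall z, 0 < df z) ->
  (forall z, `|f z - z| <= C) ->
  exists g : R -> R, [/\ cancel g f, cancel f g
    & forall s : R, is_derive s 1 g (df (g s))^-1].
Proof.
move=> fd df0 fC.
have fder z : derivable f z 1 by case: (fd z).
have fcont : continuous f.
  by move=> z; apply: differentiable_continuous; apply/derivable1_diffP.
have fincr x y : x < y -> f x < f y.
  move=> xy.
  have [c _ e] : exists2 c, c \in `]x, y[ & f y - f x = df c * (y - x).
    by apply: MVT => //; apply: continuous_subspaceT.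
  by rewrite -subr_gt0 e mulr_gt0 ?subr_gt0.
have finj : injective f.
  by move=> x y e; case: (ltgtP x y) => // /fincr; rewrite e ltxx.
have fsurj s : exists z, f z = s.
  have C0 : 0 <= C by apply: le_trans (fC 0).
  have [z _ <-] : exists2 z, z \in `[s - C, s + C] & f z = s; last by exists z.
    have lo := fC (s - C); have hi := fC (s + C).
    rewrite ler_norml in lo; rewrite ler_norml in hi.
    apply: IVT; [lra|exact: continuous_subspaceT|].
    by rewrite ge_min le_max; apply/andP; split; apply/orP; [left|right]; lra.
have [g gK] := choice fsurj.
have fK : cancel f g by move=> z; apply: finj; rewrite gK.
exists g; split=> // s.
have := @is_derive_inverse _ f g (df (g s)) (g s); rewrite gK; apply.
- by near=> z; exact: fK.
- by near=> z; exact: fcont.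
- by rewrite gt_eqF.
Unshelve. all: by end_near. Qed.

(** The Kepler equation of motion, one coordinate at a time.  Here [Z] is the
    increment of the eccentric anomaly since time 0, [n] the mean motion,
    [al] and [be] are [e cos E0] and [e sin E0] for the eccentricity [e] and
    the initial anomaly [E0], and [rho (Z s)] is the distance to the origin
    divided by the semi-major axis.  The coordinates of an ellipse relative to
    its focus are the combinations [F] of [cos Z - al] and [sin Z + be]. *)
Lemma kepler_component (R : realType) (al be n b c : R) (Z : R -> R) :
  let rho z := 1 - al * cos z + be * sin z in
  let F s := c * be - b * al + b * cos (Z s) + c * sin (Z s) in
  let G s := (c * cos (Z s) - b * sin (Z s)) * (n / rho (Z s)) in
  (forall z, rho z != 0) ->
  (forall s : R, is_derive s 1 Z (n / rho (Z s))) ->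
  forall s : R, is_derive s 1 F (G s) /\
    is_derive s 1 G (- (n ^+ 2 / rho (Z s) ^+ 3) * F s).
Proof.
move=> rho F G rho0 Zd s.
have cd : is_derive s 1 (fun s => cos (Z s)) (- sin (Z s) * (n / rho (Z s))).
  exact: is_derive1_comp.
have sd : is_derive s 1 (fun s => sin (Z s)) (cos (Z s) * (n / rho (Z s))).
  exact: is_derive1_comp.
have rd : is_derive s 1 (fun s => rho (Z s))
    ((al * sin (Z s) + be * cos (Z s)) * (n / rho (Z s))).
  by apply: is_derive_eq; rewrite /GRing.scale /=; ring.
split.
  by apply: is_derive_eq; rewrite /G /GRing.scale /=; ring.
have ird := @is_deriveV _ (fun s => rho (Z s)) s _ 1 (rho0 (Z s)) rd.
apply: is_derive_eq; rewrite /GRing.scale /=.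
have -> : F s =
    (c * cos (Z s) - b * sin (Z s)) * (al * sin (Z s) + be * cos (Z s))
    + rho (Z s) * (c * sin (Z s) + b * cos (Z s)).
  rewrite [RHS](_ : _ = (c * be - b * al) * (cos (Z s) ^+ 2 + sin (Z s) ^+ 2)
    + b * cos (Z s) + c * sin (Z s)); last by rewrite /rho; ring.
  by rewrite cos2Dsin2 mulr1.
by move: (rho0 (Z s)); move: (rho (Z s)) => d d0; field.
Qed.

(** The motion is [x = f r + g v], with [v] the initial velocity and [f], [g]
    the Lagrange coefficients, so it lies in the plane of [r] and [v] and has
    the required initial data at time 0 by construction.  The condition of
    nonzero angular momentum says that the eccentricity is less than 1
    ([ecc]), which keeps the distance to the origin and the derivative of the
    Kepler equation positive. *)
Lemma kepler_orbit_exists (R : realType) (mu k H : R) (Pi : {vspace 'rV[R]_3})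
    (r p : 'rV[R]_3) :
  0 < mu -> 0 < k -> H < 0 -> r \in Pi -> p \in Pi -> crossp r p != 0 ->
  enorm p ^+ 2 / (2%:R * mu) - k / enorm r = H ->
  exists E, kepler_orbit mu k Pi r p E.
Proof.
move=> mu0 k0 H0 rPi pPi L0 en.
have r0 : 0 < enorm r.
  rewrite enorm_gt0; apply: contra_neq L0 => ->.
  by rewrite crossp_anti crossp0r oppr0.
pose a := - k / (2 * H); pose v := mu^-1 *: p.
have a0 : 0 < a.
  by rewrite /a mulNr -mulrN -invrN divr_gt0// oppr_gt0 pmulr_rlt0.
pose rho0 := enorm r / a; pose n := Num.sqrt (k / mu / a ^+ 3).
have rho0_gt0 : 0 < rho0 by rewrite divr_gt0.
have n0 : 0 < n by rewrite sqrtr_gt0 !divr_gt0// exprn_gt0.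
have n2 : n ^+ 2 = k / mu / a ^+ 3.
  by rewrite sqr_sqrtr// !mulr_ge0 ?invr_ge0 ?exprn_ge0// ltW.
pose al := 1 - rho0; pose be := dotp r v / (n * a ^+ 2).
have rr : dotp r r = a ^+ 2 * rho0 ^+ 2.
  by rewrite -enorm_sqr /rho0; field; rewrite gt_eqF.
have rv : dotp r v = a ^+ 2 * n * be.
  by rewrite /be; field; rewrite !gt_eqF.
have vv : dotp v v = a ^+ 2 * n ^+ 2 * (2 / rho0 - 1).
  rewrite /v dotpZl dotpZr -enorm_sqr.
  have -> : enorm p ^+ 2 = 2 * mu * (H + k / enorm r).
    by rewrite -en; field; rewrite !gt_eqF.
  have -> : H = - k / (2 * a).
    by rewrite /a; field; rewrite (lt_eqF H0) (gt_eqF k0).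
  by rewrite n2 /rho0; field; rewrite !gt_eqF.
have ecc : al ^+ 2 + be ^+ 2 < 1.
  have : 0 < dotp (crossp r p) (crossp r p) by rewrite dotp_gt0.
  have -> : crossp r p = mu *: crossp r v.
    by rewrite -crosspZr /v scalerA mulfV ?scale1r// gt_eqF.
  rewrite dotpZl dotpZr !pmulr_rgt0// dotp_crossp rr rv vv.
  rewrite [X in 0 < X](_ : _ = a ^+ 4 * n ^+ 2 * (1 - (al ^+ 2 + be ^+ 2))).
    by rewrite pmulr_rgt0 ?subr_gt0// mulr_gt0// exprn_gt0.
  by rewrite /al; field; rewrite gt_eqF.
have muv : mu *: v = p by rewrite /v scalerA mulfV ?scale1r// gt_eqF.
have vPi : v \in Pi by rewrite memvZ.
clearbody v.
pose rho z := 1 - al * cos z + be * sin z.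
have rho_gt0 z : 0 < rho z.
  have : (al * cos z - be * sin z) ^+ 2 < 1.
    apply: le_lt_trans ecc.
    rewrite -[leRHS]mulr1 -(cos2Dsin2 z) -subr_ge0.
    rewrite [X in 0 <= X](_ : _ = (al * sin z + be * cos z) ^+ 2) ?sqr_ge0//.
    ring.
  have -> : rho z = 1 - (al * cos z - be * sin z) by rewrite /rho; ring.
  by move: (al * cos z - be * sin z) => x x1; nra.
have [tau' [tau'K tauK tau'd]] : exists g : R -> R,
    [/\ cancel g (fun z => z - al * sin z + be * (1 - cos z)),
        cancel (fun z => z - al * sin z + be * (1 - cos z)) g
      & forall s : R, is_derive s 1 g (rho (g s))^-1].
  apply: (derivative_pos_inverse (C := 3)) => // z.
    by apply: is_derive_eq; rewrite /rho /GRing.scale /=; ring.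
  have bound1 (x y : R) : x ^+ 2 + y ^+ 2 < 1 -> `|x| <= 1.
    by rewrite ler_norml => h; apply/andP; split; nra.
  have al1 := bound1 _ _ ecc.
  have be1 : `|be| <= 1 by apply: (bound1 _ al); rewrite addrC.
  rewrite (_ : _ - z = - (al * sin z) + be + - (be * cos z)); last by ring.
  rewrite (le_trans (ler_normD _ _))// (_ : 3 = 1 + 1 + 1 :> R); last by ring.
  rewrite lerD// ?(le_trans (ler_normD _ _))// ?lerD// normrN normrM.
    by rewrite mulr_ile1 ?sin_max.
  by rewrite mulr_ile1 ?cos_max.
pose Z s := tau' (n * s).
have Zd (s : R) : is_derive s 1 Z (n / rho (Z s)).
  have nd : is_derive s 1 (fun s => n * s) n.
    by apply: is_derive_eq; rewrite /GRing.scale /=; ring.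
  have h := is_derive1_comp (tau'd (n * s)) nd.
  by apply: is_derive_eq; rewrite mulrC.
have Z0 : Z 0 = 0.
  by rewrite /Z mulr0 -[RHS]tauK sin0 cos0 subrr !mulr0 !subr0 addr0.
have rhoN z : rho z != 0 by rewrite gt_eqF.
pose f s := 0 * be - rho0^-1 * al + rho0^-1 * cos (Z s) + 0 * sin (Z s).
pose g s := rho0 / n * be - (- be / n) * al + (- be / n) * cos (Z s)
  + rho0 / n * sin (Z s).
pose f' s := (0 * cos (Z s) - rho0^-1 * sin (Z s)) * (n / rho (Z s)).
pose g' s := (rho0 / n * cos (Z s) - (- be / n) * sin (Z s)) * (n / rho (Z s)).
pose x s := f s *: r + g s *: v.
pose x' s := f' s *: r + g' s *: v.
have xd (s : R) : is_derive s 1 x (x' s).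
  have [fd _] := kepler_component (rho0^-1) 0 rhoN Zd s.
  have [gd _] := kepler_component (- be / n) (rho0 / n) rhoN Zd s.
  have frd := is_derive_scale_vec r fd.
  have gvd := is_derive_scale_vec v gd.
  exact: is_deriveD.
have xd' (s : R) : is_derive s 1 x' (- (n ^+ 2 / rho (Z s) ^+ 3) *: x s).
  have [_ fd] := kepler_component (rho0^-1) 0 rhoN Zd s.
  have [_ gd] := kepler_component (- be / n) (rho0 / n) rhoN Zd s.
  have frd := is_derive_scale_vec r fd.
  have gvd := is_derive_scale_vec v gd.
  by apply: is_derive_eq; rewrite /x scalerDr !scalerA.
have x'E : derive1 x = x'.
  by apply/funext => s; rewrite derive1E; case: (xd s).
have xnorm s : enorm (x s) = a * rho (Z s).
  apply/enorm_eq; first by rewrite ltW// mulr_gt0.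
  rewrite /x !dotp_lin (dotpC v r) rr rv vv.
  (* The two sides are quadratic polynomials in the cosine and the sine whose
     difference is a multiple of cos^2 + sin^2 - 1. *)
  rewrite [LHS](_ : _ = (a * rho (Z s)) ^+ 2 +
    a ^+ 2 * (2 * rho0 - rho0 ^+ 2 - be ^+ 2)
      * (cos (Z s) ^+ 2 + sin (Z s) ^+ 2 - 1)).
    by rewrite cos2Dsin2 subrr mulr0 addr0.
  by rewrite /f /g /rho /al; field; rewrite !gt_eqF.
exists (range x), x; split=> //.
- move=> s; split.
  + by rewrite -enorm_gt0 xnorm mulr_gt0.
  + by case: (xd s).
  + by rewrite x'E; case: (xd' s).
  + rewrite x'E derive1E; case: (xd' s) => _ ->.
    rewrite scalerA xnorm; congr (_ *: _); rewrite n2.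
    by field; rewrite !gt_eqF.
- by move=> s; rewrite memvD// memvZ.
- exists 0; rewrite x'E /x /x' /f /g /f' /g' Z0 /rho cos0 sin0 -muv.
  have -> : 1 - al * 1 + be * 0 = rho0 by rewrite /al; ring.
  split; last congr (_ *: _).
    have -> : 0 * be - rho0^-1 * al + rho0^-1 * 1 + 0 * 0 = 1.
      by rewrite /al; field; rewrite gt_eqF.
    rewrite (_ : _ + rho0 / n * 0 = 0) ?scale1r ?scale0r ?addr0//.
    by rewrite /al; field; rewrite gt_eqF.
  have -> : (0 * 1 - rho0^-1 * 0) * (n / rho0) = 0 by ring.
  have -> : (rho0 / n * 1 - - be / n * 0) * (n / rho0) = 1.
    by field; rewrite !gt_eqF.
  by rewrite scale1r scale0r add0r.
Qed.

(** * The second focus and the directrix *)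

(** The right-hand side is a multiple of the mirror image of [r] in the line
    spanned by [p]: this is the focal property of the tangent. *)
Lemma second_focus_sub (R : realType) (mu k H : R) (r p : 'rV[R]_3) :
  mu != 0 -> H != 0 ->
  enorm p ^+ 2 / (2 * mu) - k / enorm r = H ->
  second_focus mu k H r p - r
    = (mu * H)^-1 *: ((dotp p p / 2) *: r - dotp r p *: p).
Proof.
move=> mu0 H0 en; apply: (scalerI (mulf_neq0 mu0 H0)).
rewrite scalerBr /second_focus !scalerA mulfV ?mulf_neq0// !scale1r /lenz.
have -> : mu * H = dotp p p / 2 - k * mu / enorm r.
  by rewrite -en enorm_sqr; move: (enorm r)^-1 => x; field.
rewrite crossp_crossp (dotpC p r); move: (enorm r)^-1 => x.
by apply/rowP => i; rewrite !mxE; field.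
Qed.

Lemma energy_dotp (R : realType) (mu k H : R) (r p : 'rV[R]_3) :
  mu != 0 -> enorm p ^+ 2 / (2 * mu) - k / enorm r = H ->
  dotp p p = 2 * mu * (H + k / enorm r).
Proof.
by move=> mu0 <-; rewrite -enorm_sqr; move: (enorm r)^-1 => x; field.
Qed.

(** The orbit passes through [r], and its major axis is [- k / H]. *)
Lemma second_focus_dist (R : realType) (mu k H : R) (r p : 'rV[R]_3) :
  0 < mu -> H < 0 -> r != 0 -> enorm r < - k / H ->
  enorm p ^+ 2 / (2 * mu) - k / enorm r = H ->
  enorm (second_focus mu k H r p - r) = - k / H - enorm r.
Proof.
move=> mu0 H0 r0 rk en; have nr0 : 0 < enorm r by rewrite enorm_gt0.
rewrite (second_focus_sub _ _ en) ?(gt_eqF mu0) ?(lt_eqF H0)//.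
apply/enorm_eq; first by rewrite subr_ge0 ltW.
rewrite !dotp_lin (dotpC p r) (energy_dotp _ en) ?gt_eqF// -enorm_sqr.
by field; rewrite (gt_eqF nr0) (gt_eqF mu0) (lt_eqF H0).
Qed.

(** With [K] the Lenz vector, the directrix has the equation [x.K = L^2], and
    [r.K = L^2 - k mu |r|]; dividing the difference by [mu H] eliminates the
    angular momentum, so that the line depends on [t] only. *)
Lemma directrixE (R : realType) (mu k H : R) (Pi : {vspace 'rV[R]_3})
    (r p : 'rV[R]_3) :
  let t := second_focus mu k H r p in
  mu != 0 -> H != 0 -> r \in Pi -> p \in Pi -> r != 0 -> t != 0 ->
  directrix mu k Pi r p
    = [set x | x \in Pi /\ dotp (x - r) t = k / H * enorm r].
Proof.
move=> t mu0 H0 rPi pPi r0 t0.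
have nr0 : enorm r != 0 by rewrite gt_eqF// enorm_gt0.
set K := lenz mu k r p.
have tE : t = (mu * H)^-1 *: K by [].
have K0 : dotp K K != 0.
  by rewrite dotp_eq0; apply: contra_neq t0 => K0; rewrite tE K0 scaler0.
have KPi : K \in Pi.
  by rewrite /K /lenz crossp_crossp memvB ?memvB ?memvZ.
have rK : dotp r K = enorm (crossp r p) ^+ 2 - k * mu * enorm r.
  rewrite enorm_sqr dotp_crossp /K /lenz crossp_crossp !dotp_lin (dotpC p r).
  by rewrite -(enorm_sqr r); field.
have muH : mu * H != 0 by rewrite mulf_neq0.
have eqD x : dotp (x - r) t = k / H * enorm r
    <-> dotp x K = enorm (crossp r p) ^+ 2.
  rewrite tE dotpZr dotpDl dotpNl rK.
  split=> [e|->]; last by field; rewrite H0 mu0.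
  apply/eqP; rewrite -subr_eq0; apply/eqP.
  have := congr1 (fun y => mu * H * y) e; rewrite mulrA mulfV// mul1r.
  rewrite (_ : mu * H * (k / H * _) = k * mu * enorm r); last by field.
  by lra.
apply/seteqP; split=> x /=.
  move=> [n [nPi nK ->]]; split; first by rewrite memvD// memvZ.
  apply/eqD; rewrite dotpDl dotpZl nK (enorm_sqr K); field.
  exact: K0.
move=> [xPi /eqD xK].
exists (x - (enorm (crossp r p) ^+ 2 / enorm K ^+ 2) *: K).
split; [by rewrite memvB// memvZ| |by rewrite addrC subrK].
by rewrite dotpDl dotpNl dotpZl xK (enorm_sqr K) mulfVK// subrr.
Qed.

(** Two unit vectors of a plane are mirror images of each other in some line:
    the one spanned by their sum or, for opposite vectors, the perpendicular
    line. *)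
Lemma bisecting_unit_vector (R : realType) (Pi : {vspace 'rV[R]_3})
    (e w : 'rV[R]_3) :
  \dim Pi = 2%N -> e \in Pi -> w \in Pi -> dotp e e = 1 -> dotp w w = 1 ->
  exists d, [/\ d \in Pi, dotp d d = 1 & (2 * dotp e d) *: d = e + w].
Proof.
move=> /plane_normal[nu nuP] ePi wPi e1 w1.
have [ew|ew] := eqVneq (e + w) 0.
  exists (crossp nu e); rewrite (memv_crossp_normal _ nuP).
  by rewrite (dotp_crossp_normal nuP)// dotp_crosspr mulr0 scale0r ew.
have m0 : 0 < enorm (e + w) by rewrite enorm_gt0.
have m2 : enorm (e + w) ^+ 2 = 2 * (1 + dotp e w).
  by rewrite enorm_sqr !dotp_lin e1 w1 (dotpC w e); ring.
exists ((enorm (e + w))^-1 *: (e + w)); split.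
- by rewrite memvZ// memvD.
- by rewrite dotpZl dotpZr -enorm_sqr; field; rewrite gt_eqF.
- rewrite scalerA dotpZr dotpDr e1.
  rewrite (_ : _ * _ = 2 * (1 + dotp e w) / enorm (e + w) ^+ 2); last first.
    by field; rewrite gt_eqF.
  by rewrite -m2 mulfV ?scale1r// expf_neq0// gt_eqF.
Qed.

(** By [second_focus_sub] the direction of the momentum has to bisect the angle
    between [r] and [t - r], and its length is prescribed by the energy.  When
    [t - r] points away from the origin this gives the degenerate member. *)
Lemma momentum_of_focus (R : realType) (mu k H : R) (Pi : {vspace 'rV[R]_3})
    (r t : 'rV[R]_3) :
  0 < mu -> H < 0 -> \dim Pi = 2%N -> r \in Pi -> t \in Pi ->
  r != 0 -> enorm r < - k / H -> enorm (t - r) = - k / H - enorm r ->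
  exists p, [/\ p \in Pi, enorm p ^+ 2 / (2 * mu) - k / enorm r = H
    & second_focus mu k H r p = t].
Proof.
move=> mu0 H0 d2 rPi tPi r0 rk tr.
have nr0 : 0 < enorm r by rewrite enorm_gt0.
pose l := - k / H - enorm r; have l0 : 0 < l by rewrite subr_gt0.
pose e := (enorm r)^-1 *: r; pose w := l^-1 *: (t - r).
have tw : t - r = l *: w by rewrite /w scalerA mulfV ?scale1r// gt_eqF.
have [||||d [dPi d1 dE]] := @bisecting_unit_vector R Pi e w d2.
- by rewrite memvZ.
- by rewrite memvZ// memvB.
- by rewrite /e dotpZl dotpZr -enorm_sqr; field; rewrite gt_eqF.
- by rewrite /w dotpZl dotpZr -enorm_sqr tr -/l; field; rewrite gt_eqF.
have rd : (2 * dotp r d) *: d = r + enorm r *: w.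
  have := congr1 (fun x => enorm r *: x) dE.
  rewrite scalerDr /e !scalerA dotpZl mulfV ?gt_eqF// scale1r => <-.
  by congr (_ *: _); field; rewrite gt_eqF.
have P0 : 0 < 2 * mu * (H + k / enorm r).
  rewrite (_ : _ + _ = - H * l / enorm r); last first.
    by rewrite /l; field; rewrite (gt_eqF nr0) (lt_eqF H0).
  by rewrite mulr_gt0// ?divr_gt0// mulr_gt0// oppr_gt0.
pose P := Num.sqrt (2 * mu * (H + k / enorm r)).
have P2 : P ^+ 2 = 2 * mu * (H + k / enorm r) by rewrite sqr_sqrtr// ltW.
have en : enorm (P *: d) ^+ 2 / (2 * mu) - k / enorm r = H.
  rewrite enorm_sqr dotpZl dotpZr d1 mulr1 -expr2 P2.
  by field; rewrite !gt_eqF.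
exists (P *: d); split=> //; first by rewrite memvZ.
apply: (addIr (- r)); rewrite tw.
rewrite (second_focus_sub _ _ en) ?(gt_eqF mu0) ?(lt_eqF H0)//.
rewrite !dotpZr dotpZl d1 mulr1 -expr2.
have -> : (P * dotp r d) *: (P *: d) = (P ^+ 2 / 2) *: ((2 * dotp r d) *: d).
  by rewrite !scalerA; congr (_ *: _); field.
clearbody w; rewrite -scalerBr rd opprD addrA subrr add0r -scaleNr !scalerA.
rewrite P2 /l.
by congr (_ *: _); field; rewrite (gt_eqF mu0) (gt_eqF nr0) (lt_eqF H0).
Qed.

(** * The envelope of the directrices *)

Theorem theorem4p1 (R : realType) (mu k H : R) (Pi : {vspace 'rV[R]_3})
    (r : 'rV[R]_3) :
  let a := - k / (2%:R * H) in
  let u := (a / (a - enorm r)) *: r in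
  let A := (2%:R * a - enorm r) * enorm r / (a - enorm r) in
  0 < mu -> 0 < k -> H < 0 ->
  \dim Pi = 2%N -> r \in Pi ->
  0 < enorm r -> enorm r < a ->
  [/\ forall (p : 'rV[R]_3) (E : set 'rV[R]_3),
        kepler_family mu k H Pi r p E ->
        let t := second_focus mu k H r p in
        exists2 v : 'rV[R]_3,
          unique (reflection_in Pi (directrix mu k Pi r p) u) v
        & [/\ v = (a / (a - enorm r)) *: r - (enorm r / (a - enorm r)) *: t,
              v - r = (enorm r / (a - enorm r)) *: (r - t),
              enorm (v - r) = A
            & circle Pi r A v],
      [set D | exists p E, kepler_family mu k H Pi r p E
                           /\ D = directrix mu k Pi r p]
        = [set D | tangent_line (ellipse Pi r u A) D],
      eccentricity r u A = (enorm r ^+ 2 / (a - enorm r)) / A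
    & (enorm r ^+ 2 / (a - enorm r)) / A = enorm r / (2%:R * a - enorm r)].
Proof.
move=> a u A mu0 k0 H0 d2 rPi nr0 ra.
have r0 : r != 0 by rewrite -enorm_gt0.
have ar0 : 0 < a - enorm r by rewrite subr_gt0.
have a2 : - k / H = 2 * a by rewrite /a; field; rewrite lt_eqF.
have l0 : 0 < 2 * a - enorm r by lra.
have rk : enorm r < - k / H by rewrite a2; lra.
pose s := enorm r / (a - enorm r).
have s0 : 0 < s by rewrite divr_gt0.
have uE : u - r = s *: r.
  rewrite /u -[X in _ - X]scale1r -scalerBl; congr (_ *: _).
  by rewrite /s; field; rewrite gt_eqF.
have AE : A = s * (2 * a - enorm r).
  by rewrite /A /s; field; rewrite gt_eqF.
have A0 : 0 < A by rewrite AE mulr_gt0//; lra.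
have uPi : u \in Pi by rewrite memvZ.
have urn : enorm (u - r) = s * enorm r by rewrite uE enormZ// ltW.
have urA : enorm (u - r) < A by rewrite urn AE ltr_pM2l//; lra.
pose D t := [set x | x \in Pi /\ dotp (x - r) t = - (2 * a * enorm r)].
(* D t is the directrix expressed through the second focus t. *)
have famP p : p \in Pi -> enorm p ^+ 2 / (2%:R * mu) - k / enorm r = H ->
    let t := second_focus mu k H r p in
    [/\ t \in Pi, enorm (t - r) = 2 * a - enorm r, t != 0
      & directrix mu k Pi r p = D t].
  move=> pPi en t.
  have tPi : t \in Pi.
    by rewrite memvZ// /lenz crossp_crossp memvB ?memvB ?memvZ.
  have tr : enorm (t - r) = 2 * a - enorm r.
    by rewrite -a2; apply: second_focus_dist.
  have t0 : t != 0.
    apply/eqP => t0; move: tr; rewrite t0 sub0r.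
    by rewrite enormN => e; lra.
  split=> //; rewrite (directrixE (H := H)) ?(gt_eqF mu0) ?(lt_eqF H0)// /D.
  by rewrite (_ : k / H = - (2 * a)) ?mulNr// -a2 mulNr opprK.
(* The dilation by s takes the circle of second foci to the circle of
   radius A, so that A w - (u - r) = - s t. *)
have tangent_D t w : r - t = (2 * a - enorm r) *: w ->
    D t = [set x | x \in Pi /\ dotp (x - r) (A *: w - (u - r))
                     = (A ^+ 2 - enorm (u - r) ^+ 2) / 2].
  move=> tw.
  have -> : A *: w - (u - r) = - s *: t.
    by rewrite uE AE -scalerA -tw -scalerBr addrAC subrr add0r scaleNr scalerN.
  have -> : (A ^+ 2 - enorm (u - r) ^+ 2) / 2 = - s * - (2 * a * enorm r).
    by rewrite urn AE /s; field; rewrite gt_eqF.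
  have sN : - s != 0 by rewrite oppr_eq0 gt_eqF.
  apply/seteqP; split=> x /= [xPi e]; split=> //; first by rewrite dotpZr e.
  by apply: (mulfI sN); rewrite -e dotpZr.
split.
- move=> p E [pPi en _ _] t; have [tPi tr t0 ->] := famP p pPi en.
  rewrite -/t in tPi tr t0 *; rewrite -/s; clearbody t.
  have tt : dotp t t = 4 * a ^+ 2 - 4 * a * enorm r + 2 * dotp r t.
    have := enorm_sqr (t - r); rewrite tr !dotp_lin -(enorm_sqr r) (dotpC t r).
    by move=> h; lra.
  have vu : (a / (a - enorm r)) *: r - s *: t = u - s *: t by [].
  have vr : u - s *: t - r = s *: (r - t).
    by rewrite addrAC uE -scalerBr.
  have vn : enorm (u - s *: t - r) = A.
    rewrite vr enormZ ?ltW// AE -tr; congr (_ * _).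
    by rewrite -opprB enormN.
  have vPi : u - s *: t \in Pi by rewrite memvB// memvZ.
  exists (u - s *: t); last by split.
  rewrite -scaleNr; apply: unique_reflection_in => //.
  by rewrite uE dotpZl tt /s; field; rewrite gt_eqF.
- apply/seteqP; split=> l /=.
    move=> [p [E [[pPi en _ _] ->]]].
    have [tPi tr t0 ->] := famP p pPi en.
    apply/tangent_line_ellipseP => //.
    set t := second_focus mu k H r p in tPi tr *.
    exists ((2 * a - enorm r)^-1 *: (r - t)); split.
    + by rewrite memvZ// memvB.
    + rewrite dotpZl dotpZr -enorm_sqr (_ : enorm (r - t) = 2 * a - enorm r).
        by field; rewrite gt_eqF.
      by rewrite -tr -opprB enormN.
    + by apply: tangent_D; rewrite scalerA mulfV ?scale1r// gt_eqF.
  move=> /(tangent_line_ellipseP _ d2 rPi uPi urA)[w [wPi w1 ->]].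
  pose t := r - (2 * a - enorm r) *: w.
  have tPi : t \in Pi by rewrite memvB// memvZ.
  have tr : enorm (t - r) = - k / H - enorm r.
    rewrite a2 /t addrAC subrr add0r -scaleNr; apply/enorm_eq; first exact: ltW.
    by rewrite dotpZl dotpZr w1; ring.
  have [p [pPi en tE]] := momentum_of_focus mu0 H0 d2 rPi tPi r0 rk tr.
  have [E EP] : exists E, kepler_family mu k H Pi r p E.
    have [L0|L0] := eqVneq (crossp r p) 0.
      exists (ellipse Pi 0 (second_focus mu k H r p) (- k / H)).
      by split=> //; rewrite L0 eqxx.
    have [E EP] := kepler_orbit_exists mu0 k0 H0 rPi pPi L0 en.
    by exists E; split=> // L0'; rewrite L0' eqxx in L0.
  exists p, E; split=> //; have [_ _ _ ->] := famP p pPi en; rewrite tE.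
  by apply/esym/tangent_D; rewrite /t opprB addrCA subrr addr0.
- rewrite /eccentricity urn /s; congr (_ / _).
  by field; rewrite gt_eqF.
- by rewrite /A; field; rewrite !gt_eqF.
Qed.
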